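(* Let $G=(V,b,m)$ be a graph. (i) Let $N\subset G$ be an infinite connected subgraph of $G$ with non-empty interior. If $N$ is $\mathcal D$-$L^1$-Liouville, then $G$ is $L^1$-Liouville. (ii) If there exist a sequence $\{N_k\}_k$ of infinite connected subgraphs of $G$ and a vertex $x_0\in V$ belonging to every $N_k$ such that ${}^{\mathcal D}E_{N_k}(x_0)\to\infty$ as $k\to\infty$, then $G$ is $L^1$-Liouville.
   Context: A graph is a triple $G=(V,b,m)$, where $V$ is the (countable) set of vertices, $b:V\times V\to[0,\infty)$ is symmetric and vanishes on the diagonal, and $m:V\to(0,\infty)$. Write $x\sim y$ if $b(x,y)\neq 0$. $G$ is assumed connected (any two vertices are joined by a finite path of neighbors) and locally finite ($\{y: b(x,y)\ne 0\}$ is finite for every $x$). The Laplacian is $\Delta f(x)=\frac1{m(x)}\sum_{y\in V}b(x,y)(f(x)-f(y))$ (positive sign convention). $G$ is $L^1$-Liouville if every non-negative $u:V\to\mathbb R$ with $\sum_{x\in V}u(x)m(x)<\infty$ and $\Delta u\ge 0$ on $V$ is constant. A subgraph is $N=(W,b|_{W\times W},m|_W)$ with $W\subset V$. Its interior is $\mathrm{int}\,N=\{y\in W:\ b(x,y)=0 \text{ for all } x\in V\setminus W\}$ and its (inner) boundary is $\partial N=W\setminus\mathrm{int}\,N$; the same notation is used for subsets of $V$. For a function $u$ on $W$ and $x\in\mathrm{int}\,N$, $\Delta u(x)$ only involves values of $u$ on $W$. $N$ is $\mathcal D$-$L^1$-Liouville if every non-negative function $u$ on $W$ with $\sum_{x\in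 W}u(x)m(x)<\infty$, $\Delta u\ge0$ in $\mathrm{int}\,N$ and $u=0$ on $\partial N$ vanishes identically. The Dirichlet mean exit time ${}^{\mathcal D}E_N$ of an infinite connected subgraph $N$ is the monotone limit ${}^{\mathcal D}E_N=\lim_r{}^{\mathcal D}E_r\in[0,\infty]$, where $\{\Omega_r\}$ is an increasing exhaustion of $W$ by finite sets and ${}^{\mathcal D}E_r$ is the solution of $\Delta\,{}^{\mathcal D}E_r=1$ in $\mathrm{int}\,\Omega_r$, ${}^{\mathcal D}E_r=0$ on $\partial\Omega_r$. If finite, it is the minimal positive solution of $\Delta\,{}^{\mathcal D}E_N=1$ in $\mathrm{int}\,N$, ${}^{\mathcal D}E_N=0$ on $\partial N$. *)

(* Defs.v *)
From HB Require Import structures.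
From mathcomp Require Import all_boot all_order all_algebra.
From mathcomp Require Import all_classical all_reals all_analysis.
Import Order.TTheory GRing.Theory Num.Theory.
Import numFieldNormedType.Exports.

Set Implicit Arguments.
Unset Strict Implicit.
Unset Printing Implicit Defensive.

Local Open Scope classical_set_scope.
Local Open Scope ring_scope.

(* Connectedness and local finiteness are the separate predicates
   [connected_graph] and [locally_finite] below. *)
Record wgraph (R : realType) (V : countType) := WGraph {
  gweight : V -> V -> R;
  gmeas : V -> R;
  gweight_ge0 : forall x y, 0 <= gweight x y;
  gweight_sym : forall x y, gweight x y = gweight y x;
  gweight_diag : forall x, gweight x x = 0;
  gmeas_gt0 : forall x, 0 < gmeas x
}.

Section Graph.
Variables (R : realType) (V : countType) (G : wgraph R V).
Implicit Types (W : set V) (u : V -> R).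

Definition adj : rel V := fun x y => gweight G x y != 0.

Definition locally_finite : Prop :=
  forall x, finite_set [set y | adj x y].

(* A subgraph N = (W, b|W, m|W) is represented by its vertex set W; it is
   connected when any two of its vertices are joined by a path inside W. *)
Definition connected_subgraph W : Prop :=
  forall x y, W x -> W y ->
    exists p : seq V,
      [/\ path adj x p, last x p = y & forall z, z \in p -> W z].

Definition connected_graph : Prop := connected_subgraph [set: V].

(* The sum is a finitely supported one as soon as G is locally finite. *)
Definition laplacian u (x : V) : R :=
  (gmeas G x)^-1 *
    \sum_(y \in [set: V]) (gweight G x y * (u x - u y)).

Definition gint W : set V :=
  [set y | W y /\ forall x, ~ W x -> gweight G x y = 0].

Definition gbd W : set V := W `\` gint W.

(* Meant for u nonnegative on W. *)
Definition summable_on W u : Prop :=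
  (\esum_(x in W) (u x * gmeas G x)%:E < +oo)%E.

Definition L1_Liouville : Prop :=
  forall u, (forall x, 0 <= u x) ->
    summable_on [set: V] u ->
    (forall x, 0 <= laplacian u x) ->
    exists c : R, forall x, u x = c.

(* In this definition and the next ones, a function on W is represented by a
   function on V whose values outside W are arbitrary: at points of gint W the
   Laplacian only involves values on W. *)
Definition D_L1_Liouville W : Prop :=
  forall u, (forall x, W x -> 0 <= u x) ->
    summable_on W u ->
    (forall x, gint W x -> 0 <= laplacian u x) ->
    (forall x, gbd W x -> u x = 0) ->
    forall x, W x -> u x = 0.

Definition finite_exhaustion W (Om : nat -> set V) : Prop :=
  [/\ forall r, finite_set (Om r),
      forall r, Om r `<=` Om r.+1
    & \bigcup_r Om r = W].

Definition D_exit_solution (Om : set V) u : Prop :=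
  (forall x, gint Om x -> laplacian u x = 1) /\
  (forall x, gbd Om x -> u x = 0).

(* E is the Dirichlet mean exit time of the subgraph on W. For G infinite,
   connected and locally finite, each Dirichlet problem has a unique solution
   on Om r, and the limit on W exists and does not depend on the exhaustion, so
   that E is determined on W. A point of W lies in Om r for r large, hence the
   values of e r outside Om r play no role. *)
Definition D_mean_exit_time W (E : V -> \bar R) : Prop :=
  exists (Om : nat -> set V) (e : nat -> V -> R),
    [/\ finite_exhaustion W Om,
        forall r, D_exit_solution (Om r) (e r)
      & forall x, W x -> (fun r => (e r x)%:E) @ \oo --> E x].

End Graph.

(* Main.v *)
(** A nonconstant, nonnegative, integrable superharmonic function [u] yields, for
    any prescribed vertex [x], an integrable superharmonic [s] with
    [0 <= s <= u] which is not harmonic at [x].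
    (i) Take [x] in the interior of [N] and let [h] solve the Dirichlet problem
    with data [s] on the boundary; then [s - h] vanishes on the boundary, is
    superharmonic in the interior and positive at [x], so [N] is not
    D-L^1-Liouville.
    (ii) Take [x = x_0]; pairing [s] with an exit time [e] by Green's formula gives
    [m x * laplacian s x * e x <= \sum m s], a bound independent of [N]. *)
Require Import Defs.
From HB Require Import structures.
From mathcomp Require Import all_boot all_order all_algebra.
From mathcomp Require Import all_classical all_reals all_analysis.
From mathcomp Require Import lra.
Import Order.TTheory GRing.Theory Num.Theory.
Import numFieldNormedType.Exports.

Local Open Scope classical_set_scope.
Local Open Scope ring_scope.

Section WeightedGraph.
Variables (R : realType) (V : countType) (G : wgraph R V).
Hypotheses (Gconn : connected_graph G) (Glf : locally_finite G).
Implicit Types (x y : V) (u v s : V -> R) (W : set V).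

Local Notation b := (gweight G).
Local Notation m := (gmeas G).

(** * Neighbourhoods, averages and the Laplacian *)

Definition nbrs x : seq V :=
  finmap.enum_fset (fset_set [set y | adj G x y]).

Lemma mem_nbrs x y : (y \in nbrs x) = (b x y != 0).
Proof.
rewrite /nbrs in_fset_set; last exact: Glf.
by apply/idP/idP; rewrite inE.
Qed.

Lemma nbrs_gt0 x y : y \in nbrs x -> 0 < b x y.
Proof. by rewrite mem_nbrs lt_neqAle gweight_ge0 eq_sym => ->. Qed.

(** Vertices of [K] that are not neighbours have weight zero; the freedom in [K] lets one list serve
    many vertices in Green's formula. *)
Lemma gmeas_laplacian {u x} {K : seq V} :
  uniq K -> {subset nbrs x <= K} ->
  m x * laplacian G u x = \sum_(y <- K) b x y * (u x - u y).
Proof.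
move=> Ku nK; rewrite /laplacian mulrA divff ?mul1r; last first.
  by rewrite gt_eqF ?gmeas_gt0.
rewrite -[RHS](big_rmcond_in (fun y => b x y != 0)); last first.
  by move=> y _ /negPn/eqP ->; rewrite mul0r.
rewrite -[RHS]big_filter.
transitivity (\sum_(y \in [set y | b x y != 0]) (b x y * (u x - u y))).
  apply: esym; apply: fsbig_widen => // y [_ /= /negP/negPn/eqP b0].
  by rewrite b0 mul0r.
apply: fsbig_fwiden.
- by move=> y /= by0; rewrite mem_filter by0 nK// mem_nbrs.
- exact: filter_uniq.
- by move=> y [/=]; rewrite mem_filter => /andP[-> _].
Qed.

Lemma nbrs_uniq x : uniq (nbrs x).
Proof. exact: finmap.fset_uniq. Qed.

Definition deg x : R := \sum_(y <- nbrs x) b x y.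

(** The transition operator of the random walk with jump probabilities [b x y / deg x]. *)
Definition avg u x : R := (deg x)^-1 * \sum_(y <- nbrs x) b x y * u y.

Lemma deg_ge0 x : 0 <= deg x.
Proof. by apply: sumr_ge0 => y _; apply: gweight_ge0. Qed.

Lemma avg_le {u v} :
  (forall x, u x <= v x) -> forall x, avg u x <= avg v x.
Proof.
move=> uv x; rewrite /avg ler_wpM2l ?invr_ge0 ?deg_ge0//.
by apply: ler_sum => y _; rewrite ler_wpM2l ?gweight_ge0.
Qed.

Lemma avg_ge0 {u} : (forall x, 0 <= u x) -> forall x, 0 <= avg u x.
Proof.
move=> u0 x; rewrite /avg mulr_ge0 ?invr_ge0 ?deg_ge0//.
by apply: sumr_ge0 => y _; rewrite mulr_ge0 ?gweight_ge0.
Qed.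

Lemma avgB u v x : avg (fun z => u z - v z) x = avg u x - avg v x.
Proof.
rewrite /avg -mulrBr -sumrB; congr (_ * _); apply: eq_bigr => y _.
by rewrite mulrBr.
Qed.

Hypothesis Vinf : infinite_set [set: V].

(** Since [V] is infinite there is a second vertex, and the first step of a path to it is a
    neighbour of [x]. *)
Lemma deg_gt0 x : 0 < deg x.
Proof.
have [y xy] : exists y, x != y.
  apply: contrapT => xV; apply: Vinf.
  apply: (sub_finite_set (B := [set x])); last exact: finite_set1.
  by move=> y _ /=; apply/eqP; rewrite eq_sym; apply: contrapT => yx;
     apply: xV; exists y; apply/negP.
have [[|z p] [/= ]] := Gconn x y I I; first by move=> _ /eqP; rewrite (negPf xy).
move=> /andP[xz _] _ _.
have zn : z \in nbrs x by rewrite mem_nbrs.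
rewrite /deg (bigD1_seq z)//= ?nbrs_uniq// ltr_pwDl ?nbrs_gt0//.
by apply: sumr_ge0 => t _; apply: gweight_ge0.
Qed.

Lemma avg_lt {u v x y} :
  (forall z, u z <= v z) -> b x y != 0 -> u y < v y -> avg u x < avg v x.
Proof.
move=> uv bxy uvy; rewrite /avg ltr_pM2l ?invr_gt0 ?deg_gt0//.
have yn : y \in nbrs x by rewrite mem_nbrs.
rewrite (bigD1_seq y) ?nbrs_uniq// [ltRHS](bigD1_seq y) ?nbrs_uniq//=.
rewrite ltr_leD ?ltr_pM2l ?nbrs_gt0//.
by apply: ler_sum => z _; rewrite ler_wpM2l ?gweight_ge0.
Qed.

Lemma avg_cst c x : avg (fun=> c) x = c.
Proof.
rewrite /avg -big_distrl/= -/(deg x) mulrA mulVf ?mul1r//.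
by rewrite gt_eqF ?deg_gt0.
Qed.

(** The measure enters only through a positive factor, so the sign of the Laplacian is that of
    [u - avg u]. *)
Lemma laplacianE u x : laplacian G u x = deg x / m x * (u x - avg u x).
Proof.
have m0 : m x != 0 by rewrite gt_eqF ?gmeas_gt0.
have d0 : deg x != 0 by rewrite gt_eqF ?deg_gt0.
apply: (mulfI m0).
rewrite (gmeas_laplacian (nbrs_uniq x))// mulrA mulrCA divff// mulr1.
rewrite mulrBr /avg mulrA divff// mul1r /deg big_distrl/= -sumrB.
by apply: eq_bigr => y _; rewrite mulrBr.
Qed.

Lemma laplacian_ge0 u x : (0 <= laplacian G u x) = (avg u x <= u x).
Proof.
by rewrite laplacianE pmulr_rge0 ?subr_ge0// divr_gt0 ?gmeas_gt0 ?deg_gt0.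
Qed.

Lemma laplacian_gt0 u x : (0 < laplacian G u x) = (avg u x < u x).
Proof.
by rewrite laplacianE pmulr_rgt0 ?subr_gt0// divr_gt0 ?gmeas_gt0 ?deg_gt0.
Qed.

(** * Superharmonic functions, strict at a prescribed vertex *)

Lemma nonconstant_edge {u} : ~ (exists c, forall x, u x = c) ->
  exists x y, b x y != 0 /\ u y < u x.
Proof.
move=> nc; apply: contrapT => ne.
have E x y : b x y != 0 -> u y = u x.
  move=> bxy; apply/eqP; rewrite eq_le !leNgt; apply/andP; split; apply/negP => h.
    by apply: ne; exists y, x; rewrite gweight_sym.
  by apply: ne; exists x, y.
have [x0|V0] := pselect (exists x0 : V, True); last first.
  by apply: nc; exists 0 => x; case: V0; exists x.
case: x0 => x0 _; apply: nc; exists (u x0) => x.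
have [p [xp <- _]] := Gconn x0 x I I.
elim: p x0 xp => //= y p IH x0 /andP[xy yp].
by rewrite -(E _ _ xy) IH.
Qed.

Lemma summable_on_le {W u v} : (forall x, W x -> u x <= v x) ->
  summable_on G W v -> summable_on G W u.
Proof.
move=> uv; apply: le_lt_trans; apply: le_esum => x Wx.
by rewrite lee_fin ler_wpM2r ?uv// ltW ?gmeas_gt0.
Qed.

(* Truncating at the upper value of a nonconstant edge makes u strictly
   superharmonic at one vertex, and averaging spreads this along paths. *)
Lemma strict_superharmonic {u} x :
  (forall z, 0 <= u z) -> (forall z, avg u z <= u z) ->
  ~ (exists c, forall z, u z = c) ->
  exists s, [/\ forall z, 0 <= s z <= u z,
                forall z, avg s z <= s z & avg s x < s x].
Proof.
move=> u0 Pu nc.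
suff H p y : path (adj G) x p -> last x p = y ->
    (exists s, [/\ forall z, 0 <= s z <= u z,
                forall z, avg s z <= s z & avg s y < s y]) ->
    exists s, [/\ forall z, 0 <= s z <= u z,
                forall z, avg s z <= s z & avg s x < s x].
  have [y [z [byz uzy]]] := nonconstant_edge nc.
  have [p [xp lp _]] := Gconn x y I I.
  apply: (H _ _ xp lp).
  have tu t : Num.min (u t) (u y) <= u t by rewrite ge_min lexx.
  have ty t : Num.min (u t) (u y) <= u y by rewrite ge_min lexx orbT.
  exists (fun t => Num.min (u t) (u y)); split.
  - by move=> t; rewrite tu le_min !u0.
  - move=> t; rewrite le_min (le_trans (avg_le tu t))//=.
    by rewrite (le_trans (avg_le ty t)) ?avg_cst.
  (* The truncation attains its maximum [u y] at [y] and is smaller at the neighbour [z]. *)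
  - rewrite minxx -[ltRHS](avg_cst (u y) y) (avg_lt ty byz)//.
    by rewrite gt_min uzy.
elim: p x => [|z p IH] x' /=; first by move=> _ ->.
move=> /andP[xz zp] lp H; have [s [su Ps Psz]] := IH _ zp lp H.
(* One step back along the path: [avg s <= s] is strict at the neighbour [z], so averaging once more
   makes it strict at [x']. *)
exists (avg s); split.
- move=> t; rewrite avg_ge0 /=; last by move=> w; have /andP[] := su w.
  by rewrite (le_trans (Ps t)); have /andP[] := su t.
- exact: avg_le.
- exact: (avg_lt Ps xz).
Qed.

(** * The Dirichlet problem and part (i) *)

(* Knaster-Tarski: [h] is the least superharmonic function on [A] among those
   which lie between 0 and [s] and coincide with [s] off [A]. *)
Lemma dirichlet_solution {A : set V} {s} :
  (forall z, 0 <= s z) -> (forall z, avg s z <= s z) ->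
  exists h, [/\ forall z, 0 <= h z <= s z, forall z, ~ A z -> h z = s z,
                forall z, A z -> avg h z = h z
              & forall z, A z -> h z <= avg s z].
Proof.
move=> s0 Ps.
pose S f := [/\ forall z, 0 <= f z <= s z, forall z, ~ A z -> f z = s z
              & forall z, A z -> avg f z <= f z].
(* One averaging sweep over [A]; it maps [S] to itself and lowers its members. *)
pose Q f z := if pselect (A z) then avg f z else f z.
have QA f z : A z -> Q f z = avg f z by rewrite /Q; case: pselect.
have QN f z : ~ A z -> Q f z = f z by rewrite /Q; case: pselect.
have QS f : S f -> S (Q f).
  move=> [fs fN Pf].
  have Qf z : Q f z <= f z.
    by have [Az|Az] := pselect (A z); [rewrite QA ?Pf|rewrite QN].
  split=> z.
  - rewrite (le_trans (Qf z)) ?andbT; last by have /andP[] := fs z.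
    have [Az|Az] := pselect (A z); last by rewrite QN//; have /andP[] := fs z.
    by rewrite QA// avg_ge0// => w; have /andP[] := fs w.
  - by move=> Az; rewrite QN// fN.
  - by move=> Az; rewrite [leRHS]QA// avg_le.
have Ss : S s by split=> // z; rewrite s0 lexx.
pose h z := inf [set f z | f in S].
have hle f z : S f -> h z <= f z.
  move=> Sf; apply: ge_inf; last by exists f.
  by exists 0 => _ [g [gs _ _] <-]; have /andP[] := gs z.
have leh c z : (forall f, S f -> c <= f z) -> c <= h z.
  by move=> cf; apply: lb_le_inf; [exists (s z), s|move=> _ [f Sf <-]; apply: cf].
have Ph z : A z -> avg h z <= h z.
  move=> Az; apply: leh => f Sf; have [_ _ /(_ _ Az)] := Sf.
  by apply: le_trans; apply: avg_le => w; apply: hle.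
have Sh : S h.
  split=> // z; last first.
    move=> Az; apply/eqP; rewrite eq_le hle//= leh// => f [_ fN _].
    by rewrite fN.
  by rewrite hle// andbT leh// => f [/(_ z)/andP[]].
exists h; split; [by case: Sh|by case: Sh| |].
(* Since [Q h] and [Q s] lie in [S], minimality of [h] gives [h <= avg h] and [h <= avg s] on
   [A]. *)
- by move=> z Az; apply/eqP; rewrite eq_le Ph//= -QA// hle//; apply: QS.
- by move=> z Az; rewrite -QA// hle//; apply: QS.
Qed.

Lemma D_L1_Liouville_L1_Liouville W :
  gint G W !=set0 -> D_L1_Liouville G W -> L1_Liouville G.
Proof.
move=> [x intx] DL u u0 us Lu; apply: contrapT => nc.
have Pu z : avg u z <= u z by rewrite -laplacian_ge0.
have [s [su Ps Psx]] := strict_superharmonic x u0 Pu nc.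
have s0 z : 0 <= s z by have /andP[] := su z.
have [h [hs hN Ph hx]] := dirichlet_solution (A := gint G W) s0 Ps.
(* Here [h x <= avg s x < s x], so [s - h] cannot vanish at [x]. *)
suff : s x - h x = 0 by have := hx x intx; lra.
have Wx : W x by case: intx.
apply: (DL (fun z => s z - h z)) => //.
- by move=> z _; rewrite subr_ge0; have /andP[] := hs z.
- have uW : summable_on G W u.
    apply: le_lt_trans us; rewrite esum_mkcond; apply: le_esum => z _.
    by case: ifP => // _; rewrite lee_fin mulr_ge0// ltW// gmeas_gt0.
  apply: (summable_on_le _ uW) => z _.
  by have := su z; have := hs z; lra.
- by move=> z Az; rewrite laplacian_ge0 avgB Ph// lerD2r.
- by move=> z [_ Az]; rewrite hN ?subrr.
Qed.

(** * Green's formula, exit times and part (ii) *)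

Lemma finite_uniq_seq {W : set V} :
  finite_set W -> exists2 K : seq V, uniq K & forall x, W x <-> x \in K.
Proof.
move=> fW; exists (finmap.enum_fset (fset_set W)); first exact: finmap.fset_uniq.
by move=> x; rewrite in_fset_set//; split; rewrite inE.
Qed.

(** Both sums range over the same list, so no boundary term appears; the products [u x * v x] agree,
    and the mixed ones are swapped by symmetry of the weight. *)
Lemma green_formula {u v} {K : seq V} :
  \sum_(x <- K) \sum_(y <- K) b x y * (u x - u y) * v x =
  \sum_(x <- K) \sum_(y <- K) b x y * (v x - v y) * u x.
Proof.
suff E (f g : V -> R) : \sum_(x <- K) \sum_(y <- K) b x y * (f x - f y) * g x =
    \sum_(x <- K) \sum_(y <- K) b x y * (f x * g x) -
    \sum_(x <- K) \sum_(y <- K) b x y * (f y * g x).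
  rewrite !E; congr (_ - _).
    by apply: eq_bigr => x _; apply: eq_bigr => y _; rewrite (mulrC (u x)).
  rewrite exchange_big; apply: eq_bigr => x _; apply: eq_bigr => y _.
  by rewrite gweight_sym (mulrC (u x)).
rewrite -sumrB; apply: eq_bigr => x _; rewrite -sumrB; apply: eq_bigr => y _.
by rewrite mulrBr mulrBl !mulrA.
Qed.

(* Green's formula for [s] and the extension [f] of [e] by zero; off the interior
   the Laplacian of [f] need not be 1, but it is nonpositive since [f >= 0]. *)
Lemma exit_solution_le (Om : set V) e s x c :
  finite_set Om -> D_exit_solution G Om e -> Om x ->
  (forall z, 0 <= s z) -> (forall z, avg s z <= s z) ->
  (\esum_(z in [set: V]) (s z * m z)%:E <= c%:E)%E ->
  m x * laplacian G s x * e x <= c.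
Proof.
move=> fOm [eint ebd] Omx s0 Ps sc.
have [K0 K0u OmK0] := finite_uniq_seq fOm.
(* [Om] with all its neighbours, so that the Laplacian at each point of [Om] is a sum over [K]. *)
pose K := undup (K0 ++ flatten [seq nbrs z | z <- K0]).
have Ku : uniq K by apply: undup_uniq.
have K0K z : z \in K0 -> z \in K by rewrite mem_undup mem_cat => ->.
have nK z : z \in K0 -> {subset nbrs z <= K}.
  move=> zK y yz; rewrite mem_undup mem_cat; apply/orP; right.
  by apply/flattenP; exists (nbrs z) => //; apply: map_f.
pose f z := if z \in K0 then e z else 0.
have fE z : Om z -> f z = e z by rewrite OmK0 /f => ->.
have f_off z : ~ gint G Om z -> f z = 0.
  rewrite /f; case: ifP => // /OmK0 Oz nz; exact: ebd.
have f_lap z : gint G Om z ->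
    \sum_(y <- K) b z y * (f z - f y) = m z.
  move=> iz; have Oz : Om z by case: iz.
  have zK0 : z \in K0 by apply/OmK0.
  rewrite -[RHS]mulr1 -(eint _ iz) (gmeas_laplacian Ku (nK _ zK0)).
  apply: eq_bigr => y _; have [Oy|Oy] := pselect (Om y); first by rewrite !fE.
  by case: iz => _ /(_ _ Oy) by0; rewrite gweight_sym by0 !mul0r.
(* Minimum principle: a negative minimum over [K] would be attained in the interior of [Om], where
   the sum in [f_lap] is positive although all its terms would be nonpositive. *)
have f0 z : 0 <= f z.
  have K_gt0 : (0 < size K)%N by case: (K) (K0K x ((OmK0 x).1 Omx)).
  have [i _ imin] := @arg_minP _ _ _ (Ordinal K_gt0) xpredT
    (fun i : 'I_(size K) => f (nth x K i)) isT.
  have fmin y : y \in K -> f (nth x K i) <= f y.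
    move=> yK; have iy : (index y K < size K)%N by rewrite index_mem.
    by have := imin (Ordinal iy) isT; rewrite /= nth_index.
  rewrite leNgt; apply/negP => fz0.
  have zK : z \in K.
    apply: K0K; apply: contraTT fz0; rewrite /f => /negPf ->.
    by rewrite ltxx.
  have fi0 : f (nth x K i) < 0 by apply: le_lt_trans fz0; apply: fmin.
  have /f_lap mi : gint G Om (nth x K i).
    by apply: contrapT => /f_off fi; rewrite fi ltxx in fi0.
  have := gmeas_gt0 G (nth x K i); rewrite -mi ltNge => /negP; apply.
  rewrite big_seq; apply: sumr_le0 => y yK.
  by rewrite mulr_ge0_le0 ?gweight_ge0// subr_le0 fmin.
have -> : e x = f x by rewrite fE.
have xK : x \in K by apply/K0K/OmK0.
apply: (@le_trans _ _ (\sum_(z <- K) \sum_(y <- K) b z y * (s z - s y) * f z)).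
  (* Off [K0], where [K] may miss neighbours of [z], the factor [f z] vanishes. *)
  have E z : \sum_(y <- K) b z y * (s z - s y) * f z =
      m z * laplacian G s z * f z.
    rewrite -big_distrl/=; have [zK0|zK0] := boolP (z \in K0); last first.
      by rewrite /f (negPf zK0) !mulr0.
    by rewrite -(gmeas_laplacian Ku (nK _ zK0)).
  rewrite (eq_bigr _ (fun z _ => E z)) (bigD1_seq x)//= lerDl.
  apply: sumr_ge0 => z _; rewrite mulr_ge0// mulr_ge0 ?laplacian_ge0//.
  by rewrite ltW ?gmeas_gt0.
(* Moving the Laplacian onto [f] leaves a finite sum bounded termwise by [s z * m z], hence by the
   full series. *)
rewrite green_formula -lee_fin; apply: le_trans sc.
apply: esum_ge; exists [set` K]; first by split => //; apply: finite_seq.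
rewrite -(fsbig_seq _ (fun z => (s z * m z)%:E))// sumEFin lee_fin.
apply: ler_sum => z _; rewrite -big_distrl/= mulrC ler_wpM2l//.
have [iz|iz] := pselect (gint G Om z); first by rewrite f_lap.
apply: (@le_trans _ _ 0); last by rewrite ltW ?gmeas_gt0.
apply: sumr_le0 => y _; rewrite (f_off _ iz) sub0r mulrN oppr_le0.
by rewrite mulr_ge0 ?gweight_ge0.
Qed.

(** From some [r0] on, [x] lies in [Om r], so the bound holds for all late [e r x] and survives the
    limit. *)
Lemma mean_exit_time_le {W E x c} :
  D_mean_exit_time G W E -> W x ->
  (forall Om e, finite_set Om -> D_exit_solution G Om e -> Om x -> e x <= c) ->
  (E x <= c%:E)%E.
Proof.
move=> [Om [e [[fOm Omi OmW] eOm cvE]]] Wx H.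
have [r0 _ r0x] : (\bigcup_r Om r) x by rewrite OmW.
have Omx r : (r0 <= r)%N -> Om r x.
  by move=> /subnK <-; elim: (r - r0)%N => // k IH; rewrite addSn; apply: Omi.
apply: (cvge_le _ (cvE x Wx)).
by exists r0 => // r /= r0r; rewrite lee_fin (H (Om r))//; apply: Omx.
Qed.

Lemma exit_time_L1_Liouville (N : nat -> set V) (E : nat -> V -> \bar R) x :
  (forall k, N k x) -> (forall k, D_mean_exit_time G (N k) (E k)) ->
  (fun k => E k x) @ \oo --> (+oo)%E -> L1_Liouville G.
Proof.
move=> Nx NE Einf u u0 us Lu; apply: contrapT => nc.
have Pu z : avg u z <= u z by rewrite -laplacian_ge0.
have [s [su Ps Psx]] := strict_superharmonic x u0 Pu nc.
have s0 z : 0 <= s z by have /andP[] := su z.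
have ss : summable_on G [set: V] s.
  by apply: (summable_on_le _ us) => z _; have /andP[] := su z.
have Sge0 : (0 <= \esum_(z in [set: V]) (s z * m z)%:E)%E.
  by apply: esum_ge0 => z _; rewrite lee_fin mulr_ge0// ltW ?gmeas_gt0.
have a0 : 0 < m x * laplacian G s x by rewrite mulr_gt0 ?laplacian_gt0 ?gmeas_gt0.
pose S := fine (\esum_(z in [set: V]) (s z * m z)%:E).
have SE : (\esum_(z in [set: V]) (s z * m z)%:E <= S%:E)%E.
  by rewrite /S fineK// ge0_fin_numE.
(* This bound depends only on [s] and [x], hence is the same for every [k]. *)
have Ele k : (E k x <= (S / (m x * laplacian G s x))%:E)%E.
  apply: (mean_exit_time_le (NE k) (Nx k)) => Om e fOm eOm Omx.
  by rewrite ler_pdivlMr// mulrC (exit_solution_le _ _ _ _ _ fOm eOm).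
have : (+oo <= (S / (m x * laplacian G s x))%:E :> \bar R)%E.
  by apply: (cvge_le _ Einf); apply: nearW.
by rewrite leye_eq.
Qed.

End WeightedGraph.

Theorem corollary5p5 (R : realType) (V : countType) (G : wgraph R V)
    (Gconn : connected_graph G) (Glf : locally_finite G) :
  (forall W : set V,
     infinite_set W -> connected_subgraph G W -> gint G W !=set0 ->
     D_L1_Liouville G W -> L1_Liouville G) /\
  ((exists (N : nat -> set V) (E : nat -> V -> \bar R) (x0 : V),
      [/\ forall k, infinite_set (N k) /\ connected_subgraph G (N k),
          forall k, N k x0,
          forall k, D_mean_exit_time G (N k) (E k)
        & (fun k => E k x0) @ \oo --> (+oo)%E]) ->
   L1_Liouville G).
Proof.
(* An infinite subgraph forces [V] to be infinite, which makes all degrees positive. *)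
have Vinf (W : set V) : infinite_set W -> infinite_set [set: V].
  by move=> Winf; apply: contra_not Winf; apply: sub_finite_set.
split=> [W /Vinf Wi _ intW|[N [E [x0 [Nk Nx NE Einf]]]]].
  exact: D_L1_Liouville_L1_Liouville intW.
have [/Vinf Wi _] := Nk 0%N.
exact: exit_time_L1_Liouville Nx NE Einf.
Qed.
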